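(* Let $\mathbb{F}$ be an algebraically closed field of characteristic $p \neq 2,3$. Let $A$ be a $1$-perfect finite dimensional associative algebra over $\mathbb{F}$, let $A' \subseteq A$ be a subalgebra, and let $B'$ be a bar-minimal Jordan-Lie inner ideal of $A'$ (that is, of the Lie algebra $A'^{(-)}$). Then there is a strict idempotent pair $(e,f)$ in $A$ such that $B' \subseteq eAf$.
   Context: Associative algebras are not required to have an identity element, and subalgebras are not required to contain an identity of the larger algebra. Characteristic $p$ may be $0$. An associative algebra is $1$-perfect if it has no (two-sided) ideals of codimension $1$. For an associative algebra $C$, $C^{(-)}$ denotes the Lie algebra on the vector space $C$ with bracket $[x,y]=xy-yx$. An inner ideal of a Lie algebra $L$ is a subspace $B$ with $[B,[B,L]] \subseteq B$. For $L = C^{(-)}$, an inner ideal $B$ of $L$ is Jordan-Lie if $B^2=0$, where $B^2$ is the span of the associative products $bb'$ with $b,b' \in B$. Let $C$ be a finite dimensional associative algebra with (nilpotent) radical $\operatorname{rad} C$, and let $L=C^{(-)}$. For a subspace $B \subseteq L$ let $\bar B$ be its image in $L/(L\cap \operatorname{rad} C)$. An inner ideal $B$ of $L$ is bar-minimal if every inner ideal $B_1$ of $L$ with $B_1 \subseteq B$ and $\bar B_1 = \bar B$ satisfies $B_1 = B$. For a subalgebra $A'$ of $A$, bar-minimality in $A'$ is taken with respect to $\operatorname{rad} A'$. An idempotent pair $(e,f)$ in $C$ consists of idempotents $e,f\in C$ (possibly zero). It is strict if for each simple component $S$ of the semisimple algebra $\bar C = C/\operatorname{rad} C$, the projections to $S$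 of the images $\bar e, \bar f$ in $\bar C$ are either both zero or both non-zero. *)

(* Defs.v *)
From HB Require Import structures.
From mathcomp Require Import all_boot all_order all_algebra.
From mathcomp Require Import boolp classical_sets.

Set Implicit Arguments.
Unset Strict Implicit.
Unset Printing Implicit Defensive.

Import GRing.Theory.
Local Open Scope ring_scope.

(* Finite dimensional associative algebras, not necessarily with an identity  *)
(* (MathComp's falgType is unital, so it is not suitable here).               *)
HB.mixin Record Vector_isAssocAlg (F : fieldType) A of Vector F A := {
  amul : A -> A -> A;
  amulA : associative amul;
  amulDl : left_distributive amul +%R;
  amulDr : right_distributive amul +%R;
  amulZl : forall (a : F) (x y : A), amul (a *: x) y = a *: amul x y;
  amulZr : forall (a : F) (x y : A), amul x (a *: y) = a *: amul x y
}.

#[short(type="assocAlgType")]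
HB.structure Definition AssocAlg (F : fieldType) :=
  {A of Vector_isAssocAlg F A & Vector F A}.

Notation "x ** y" := (amul x y) (at level 40, left associativity) : ring_scope.

Definition lie_br (F : fieldType) (A : assocAlgType F) (x y : A) : A :=
  x ** y - y ** x.

(* For a bilinear operation op this is the span of all the op u v with u in U *)
(* and v in V, see opvP; the use of bases follows falgebra.prodv.             *)
Definition opv (F : fieldType) (V : vectType F) (op : V -> V -> V)
    (U W : {vspace V}) : {vspace V} :=
  <<allpairs op (vbasis U) (vbasis W)>>%VS.

Section Bilinear.
Variables (F : fieldType) (V : vectType F) (op : V -> V -> V).
Hypothesis opDl : left_distributive op +%R.
Hypothesis opDr : right_distributive op +%R.
Hypothesis opZl : forall (a : F) (x y : V), op (a *: x) y = a *: op x y.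
Hypothesis opZr : forall (a : F) (x y : V), op x (a *: y) = a *: op x y.

Lemma memv_op (U W : {vspace V}) u w :
  u \in U -> w \in W -> op u w \in opv op U W.
Proof using opDl opDr opZl opZr.
have op0l x : op 0 x = 0 by have := opZl 0 0 x; rewrite !scale0r.
have op0r x : op x 0 = 0 by have := opZr 0 x 0; rewrite !scale0r.
move=> /coord_vbasis-> /coord_vbasis->.
rewrite (big_morph (op^~ _) (fun x y => opDl x y _) (op0l _)) memv_suml // => i _.
rewrite (big_morph (op _) (opDr _) (op0r _)); apply: memv_suml => j _.
rewrite opZl opZr !memvZ // memv_span //.
by apply/allpairsP; exists ((vbasis U)`_i, (vbasis W)`_j); rewrite !memt_nth.
Qed.

Lemma opvP (U W X : {vspace V}) :
  reflect (forall u w, u \in U -> w \in W -> op u w \in X)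
          (opv op U W <= X)%VS.
Proof using opDl opDr opZl opZr.
apply: (iffP idP) => [/subvP sX u w Uu Ww | sX].
  exact: sX (memv_op Uu Ww).
apply/span_subvP=> _ /allpairsP[[u w] /= [Uu Ww ->]].
by apply: sX; apply: vbasis_mem.
Qed.

End Bilinear.

Section Subspaces.
Variables (F : fieldType) (A : assocAlgType F).
Implicit Types (U W X C I J R B : {vspace A}) (x y e : A).

Definition mulv U W : {vspace A} := opv (@amul F A) U W.
Definition lie_brv U W : {vspace A} := opv (@lie_br F A) U W.

Lemma memv_amul U W x y : x \in U -> y \in W -> x ** y \in mulv U W.
Proof.
by apply: memv_op; [exact: amulDl|exact: amulDr|exact: amulZl|exact: amulZr].
Qed.

Lemma mulvP U W X :
  reflect (forall x y, x \in U -> y \in W -> x ** y \in X) (mulv U W <= X)%VS.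
Proof.
by apply: opvP; [exact: amulDl|exact: amulDr|exact: amulZl|exact: amulZr].
Qed.

Lemma lie_brvP U W X :
  reflect (forall x y, x \in U -> y \in W -> lie_br x y \in X)
          (lie_brv U W <= X)%VS.
Proof.
apply: opvP => [x y z|x y z|a x y|a x y]; rewrite /lie_br.
- by rewrite amulDl amulDr opprD addrACA.
- by rewrite amulDl amulDr opprD addrACA.
- by rewrite amulZl amulZr scalerBr.
- by rewrite amulZl amulZr scalerBr.
Qed.

Definition subalgebra C : bool := (mulv C C <= C)%VS.

(* Two-sided ideals of the subalgebra C.                                      *)
Definition ideal C I : bool :=
  [&& I <= C, mulv C I <= I & mulv I C <= I]%VS.

Definition one_perfect C : Prop :=
  forall I, ideal C I -> \dim C <> (\dim I).+1.

Definition simple_alg C : Prop :=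
  mulv C C <> 0%VS /\ forall I, ideal C I -> I = 0%VS \/ I = C.

(* iter n (mulv I) I is the power I^(n+1).                                    *)
Definition nilpotent I : Prop := exists n, iter n (mulv I) I = 0%VS.

Definition is_radical C R : Prop :=
  [/\ ideal C R, nilpotent R
    & forall I, ideal C I -> nilpotent I -> (I <= R)%VS].

(* The largest nilpotent ideal of C; the default 0 is never used, see radP.   *)
Definition rad C : {vspace A} := xget 0%VS [set R | is_radical C R].

Lemma amul0l x : 0 ** x = 0.
Proof. by have := amulZl 0 0 x; rewrite !scale0r. Qed.

Lemma amul0r x : x ** 0 = 0.
Proof. by have := amulZr 0 x 0; rewrite !scale0r. Qed.

Lemma mulvS U U' W W' :
  (U <= U')%VS -> (W <= W')%VS -> (mulv U W <= mulv U' W')%VS.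
Proof.
move=> /subvP sU /subvP sW; apply/mulvP=> x y Ux Wy.
by apply: memv_amul; [exact: sU|exact: sW].
Qed.

Lemma mulv_sub_assoc U W X :
  (mulv U (mulv W X) <= mulv (mulv U W) X)%VS.
Proof.
apply/mulvP=> x y Ux Wy.
pose f := linfun (amul x).
have fE z : f z = x ** z.
  rewrite /f; have lin: linear (amul x).
    by move=> a u v; rewrite amulDr amulZr.
  pose L := GRing.isLinear.Build F A A *:%R (amul x) lin.
  pose g : {linear A -> A} := HB.pack (amul x) L.
  exact: (lfunE g).
have: (mulv W X <= f @^-1: mulv (mulv U W) X)%VS.
  apply/mulvP=> w z Ww Xz; rewrite -memv_preim fE amulA.
  by apply: memv_amul => //; apply: memv_amul.
by move/subvP/(_ y Wy); rewrite -memv_preim fE.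
Qed.

Lemma ideal_add C I J : ideal C I -> ideal C J -> ideal C (I + J)%VS.
Proof.
move=> /and3P[sI /mulvP lI /mulvP rI] /and3P[sJ /mulvP lJ /mulvP rJ].
apply/and3P; split; first by rewrite subv_add sI.
  apply/mulvP=> x _ Cx /memv_addP[u Iu [v Jv ->]].
  by rewrite amulDr memv_add ?lI ?lJ.
apply/mulvP=> _ x /memv_addP[u Iu [v Jv ->]] Cx.
by rewrite amulDl memv_add ?rI ?rJ.
Qed.

Lemma nilpotent_add C I J :
  ideal C I -> ideal C J -> nilpotent I -> nilpotent J ->
  nilpotent (I + J)%VS.
Proof.
move=> /and3P[sI lI rI] /and3P[sJ lJ rJ] [n In0] [m Jm0].
set K := (I + J)%VS.
have Iexp k : (iter k (mulv I) I <= I)%VS.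
  elim: k => //= k IH; apply: subv_trans rI.
  by apply: mulvS => //; apply: subv_trans sI.
have Kexp k : (iter k (mulv K) K <= iter k (mulv I) I + J)%VS.
  elim: k => //= k IH.
  apply: subv_trans (mulvS (subvv K) IH) _.
  apply/mulvP=> _ _ /memv_addP[u Iu [v Jv ->]] /memv_addP[u' Iu' [v' Jv' ->]].
  rewrite amulDl [u ** _]amulDr -addrA memv_add //; first exact: memv_amul.
  have Cu' : u' \in C by apply: (subvP sI); apply: (subvP (Iexp k)).
  rewrite memvD //.
    by apply: (mulvP _ _ _ lJ) => //; apply: (subvP sI).
  apply: (mulvP _ _ _ rJ) => //; rewrite memvD //; exact: (subvP sJ).
have KJ : (iter n (mulv K) K <= J)%VS by have:= Kexp n; rewrite In0 add0v.
have shift k W : (iter k.+1 (mulv K) W <= mulv (iter k (mulv K) K) W)%VS.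
  elim: k W => // k IH W; rewrite iterS.
  apply: subv_trans (mulvS (subvv K) (IH W)) _.
  exact: mulv_sub_assoc.
have KJexp j : (iter (j * n.+1 + n) (mulv K) K <= iter j (mulv J) J)%VS.
  elim: j => [|j IH]; first by rewrite mul0n.
  rewrite mulSn -addnA iterD.
  apply: subv_trans (shift _ _) _.
  by rewrite iterS; apply: mulvS.
exists (m * n.+1 + n)%N; apply/eqP; rewrite -subv0 -Jm0; exact: KJexp.
Qed.

Lemma radP C : is_radical C (rad C).
Proof.
apply: (@xgetPex _ 0%VS [set R | is_radical C R]).
pose P n := `[< exists I, [/\ ideal C I, nilpotent I & \dim I = n] >].
have P0 : exists n, P n.
  exists 0%N; apply/asboolP; exists 0%VS; split; last exact: dimv0.
    apply/and3P; split; first exact: sub0v.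
      by apply/mulvP=> x y _; rewrite !memv0 => /eqP->; rewrite amul0r.
    by apply/mulvP=> x y; rewrite !memv0 => /eqP-> _; rewrite amul0l.
  by exists 0%N.
have Pub n : P n -> (n <= \dim C)%N.
  by move=> /asboolP[I [/and3P[sI _ _] _ <-]]; apply: dimvS.
have [n /asboolP[R [iR nR dR]] maxn] := ex_maxnP P0 Pub.
exists R; split=> // I iI nI.
have iK := ideal_add iR iI.
have le: (\dim (R + I)%VS <= \dim R)%N.
  rewrite dR; apply: maxn; apply/asboolP; exists (R + I)%VS; split=> //.
  exact: nilpotent_add iR iI nR nI.
have /eqP-> : R == (R + I)%VS by rewrite eqEdim addvSl.
exact: addvSr.
Qed.

Definition inner_ideal C B : bool :=
  (B <= C)%VS && (lie_brv B (lie_brv B C) <= B)%VS.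

Definition jordan_lie C B : Prop := inner_ideal C B /\ mulv B B = 0%VS.

Definition idempotent e : Prop := e ** e = e.

End Subspaces.

(* The quotient vector space V / R, modelled on a complement of R.            *)
Definition vquot (F : fieldType) (V : vectType F) (R : {vspace V}) : Type :=
  subvs_of (R^C)%VS.
HB.instance Definition _ (F : fieldType) (V : vectType F) (R : {vspace V}) :=
  Vector.on (vquot R).

Section Quotient.
Variables (F : fieldType) (V : vectType F) (R : {vspace V}).

Definition vpi : 'Hom(V, vquot R) :=
  linfun (fun v => vsproj (R^C) (daddv_pi (R^C) R v) : vquot R).

Definition vrepr (x : vquot R) : V := vsval x.

Lemma vpiE v : vpi v = vsproj (R^C) (daddv_pi (R^C) R v).
Proof.
have lin : linear (fun v => vsproj (R^C) (daddv_pi (R^C) R v) : vquot R).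
  by move=> a x y; rewrite linearP [LHS]linearP.
pose g : {linear V -> vquot R} := HB.pack
  (fun v => vsproj (R^C) (daddv_pi (R^C) R v) : vquot R)
  (GRing.isLinear.Build F V (vquot R) *:%R _ lin).
exact: (lfunE g).
Qed.

Lemma vreprK x : vpi (vrepr x) = x.
Proof.
rewrite vpiE daddv_pi_id ?subvsP ?vsvalK //.
by rewrite capvC capv_compl.
Qed.

Lemma lker_vpi : lker vpi = R.
Proof.
have RC : (R^C :&: R = 0)%VS by rewrite capvC capv_compl.
apply/eqP; rewrite eqEsubv; apply/andP; split; apply/subvP=> v.
  rewrite memv_ker vpiE => /eqP/(congr1 vsval).
  rewrite vsprojK ?memv_pi // linear0 => pi0.
  rewrite -[v](daddv_pi_add RC) ?pi0 ?add0r ?memv_pi //.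
  by rewrite addvC addv_complf memvf.
move=> Rv; rewrite memv_ker vpiE.
have vRE : daddv_pi R (R^C)%VS v = v by rewrite daddv_pi_id // capv_compl.
have: daddv_pi (R^C)%VS R v + v = v.
  rewrite -{2}vRE daddv_pi_add //.
  by rewrite addvC addv_complf memvf.
by move/(canRL (addrK _)); rewrite subrr => ->; rewrite linear0.
Qed.

Lemma vpi_eq u v : (vpi u == vpi v) = (u - v \in R).
Proof. by rewrite -subr_eq0 -linearB -memv_ker lker_vpi. Qed.

End Quotient.

Record ideal_of (F : fieldType) (A : assocAlgType F) := IdealOf {
  ideal_val :> {vspace A};
  ideal_valP : ideal {:A}%VS ideal_val
}.

Definition alg_quot (F : fieldType) (A : assocAlgType F) (I : ideal_of A)
  : Type := vquot I.
HB.instance Definition _ (F : fieldType) (A : assocAlgType F)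
  (I : ideal_of A) := Vector.on (alg_quot I).

Section QuotientAlgebra.
Variables (F : fieldType) (A : assocAlgType F) (I : ideal_of A).

Definition quot_mul (x y : alg_quot I) : alg_quot I :=
  vpi I (vrepr x ** vrepr y).

Lemma vpiM (x y : A) :
  vpi I (x ** y) = quot_mul (vpi I x : alg_quot I) (vpi I y : alg_quot I).
Proof.
have /and3P[_ /mulvP lI /mulvP rI] := ideal_valP I.
have congI z : z - vrepr (vpi I z) \in (I : {vspace A}).
  by rewrite -vpi_eq vreprK.
apply/eqP; rewrite /quot_mul vpi_eq.
set x' := vrepr _; set y' := vrepr _.
have -> : x ** y - x' ** y' = (x - x') ** y + x' ** (y - y').
  rewrite amulDl amulDr -!scaleN1r amulZl amulZr !scaleN1r.
  by rewrite addrA addrNK.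
by apply: memvD; [apply: rI|apply: lI]; rewrite ?memvf ?congI.
Qed.

Let piK (x : alg_quot I) : exists u, x = vpi I u.
Proof. by exists (vrepr x); rewrite vreprK. Qed.

Lemma quot_mulA : associative quot_mul.
Proof.
move=> x y z; have [[[u ->] [v ->]] [w ->]] := (piK x, piK y, piK z).
by rewrite -!vpiM amulA.
Qed.

Lemma quot_mulDl : left_distributive quot_mul +%R.
Proof.
move=> x y z; have [[[u ->] [v ->]] [w ->]] := (piK x, piK y, piK z).
by rewrite -linearD -!vpiM amulDl linearD.
Qed.

Lemma quot_mulDr : right_distributive quot_mul +%R.
Proof.
move=> x y z; have [[[u ->] [v ->]] [w ->]] := (piK x, piK y, piK z).
by rewrite -linearD -!vpiM amulDr linearD.
Qed.

Lemma quot_mulZl (a : F) x y : quot_mul (a *: x) y = a *: quot_mul x y.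
Proof.
have [[u ->] [v ->]] := (piK x, piK y).
by rewrite -linearZ -!vpiM amulZl linearZ.
Qed.

Lemma quot_mulZr (a : F) x y : quot_mul x (a *: y) = a *: quot_mul x y.
Proof.
have [[u ->] [v ->]] := (piK x, piK y).
by rewrite -linearZ -!vpiM amulZr linearZ.
Qed.

HB.instance Definition _ := Vector_isAssocAlg.Build F (alg_quot I)
  quot_mulA quot_mulDl quot_mulDr quot_mulZl quot_mulZr.

End QuotientAlgebra.

Section Main.
Variables (F : fieldType) (A : assocAlgType F).

(* Since rad C is contained in C, the quotient C / rad C is the image of C in *)
(* A / rad C, and the latter is used as the ambient space.                    *)
Definition bar (C B : {vspace A}) : {vspace vquot (rad C)} :=
  (vpi (rad C) @: B)%VS.

Definition bar_minimal (C B : {vspace A}) : Prop :=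
  inner_ideal C B /\
  forall B1 : {vspace A}, inner_ideal C B1 -> (B1 <= B)%VS ->
    bar C B1 = bar C B -> B1 = B.

Lemma rad_ideal : ideal {:A}%VS (rad {:A}%VS).
Proof. by case: (radP {:A}%VS). Qed.

Definition alg_bar : assocAlgType F := alg_quot (IdealOf rad_ideal).

Definition to_bar (x : A) : alg_bar := vpi (rad {:A}%VS) x.

(* S lists the simple components of Q: Q is their direct sum.                 *)
Definition simple_components (Q : assocAlgType F) (n : nat)
    (S : 'I_n -> {vspace Q}) : Prop :=
  [/\ forall i, ideal {:Q}%VS (S i) /\ simple_alg (S i),
      directv (\sum_i S i)
    & (\sum_i S i)%VS = {:Q}%VS].

(* The simple components of a semisimple algebra are unique up to order, so   *)
(* that the quantifier over their enumeration could equivalently be universal.*)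
Definition strict_pair (e f : A) : Prop :=
  exists (n : nat) (S : 'I_n -> {vspace alg_bar}),
    simple_components S /\
    forall i : 'I_n,
      sumv_pi (\sum_j S j)%VS i (to_bar e) = 0 <->
      sumv_pi (\sum_j S j)%VS i (to_bar f) = 0.

Definition strict_idempotent_pair (e f : A) : Prop :=
  [/\ idempotent e, idempotent f & strict_pair e f].

End Main.

(* Main.v *)
(* Write [R] for the radical of a subalgebra [C] containing the inner ideal   *)
(* [B], and call [(e, f)] a pair in [B] when [e C f] is contained in [B].     *)
(* A von Neumann regular [a = a x a] in [B] gives the pair [(a x, x a)].      *)
(* If it is of maximal size, the Peirce component [(1 - a x) b (1 - x a)] of  *)
(* every [b] in [B] lies in [R], since an element outside [R] has a nonzero   *)
(* regular multiple.  Enlarging first [a x] to [e] and then [x a] to [f], by  *)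
(* regular multiples of the two mixed Peirce components, one reaches a pair   *)
(* in [B] with [b - e b f] in [R] for every [b] in [B].  Then [e C f] is an   *)
(* inner ideal inside [B] with the same image modulo [R], so that it equals   *)
(* [B] by bar-minimality.  Finally [e] and [f] lie below idempotents of the   *)
(* whole algebra that lift the identity of its semisimple quotient, and these *)
(* form a strict pair.                                                        *)
Require Import Defs.
From HB Require Import structures.
From mathcomp Require Import all_boot all_order all_algebra.
From mathcomp Require Import boolp.

Set Implicit Arguments.
Unset Strict Implicit.
Unset Printing Implicit Defensive.

Import GRing.Theory.
Local Open Scope ring_scope.
Local Notation idempotent := Defs.idempotent.
Local Notation rad := Defs.rad.

(** Because [B'] squares to zero, [[a, [b, x]] = - (a x b + b x a)] on it. In characteristic other
    than 2, [B'] is therefore closed under [b x b] and its linearisation, and only this enters the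
    search for idempotents. Everything rests on one criterion: an element [c] whose right multiples
    [c s] include no nonzero idempotent is radical ([quasinil_rad], through
    [nonnilpotent_idempotent]). Conversely, a nonzero idempotent [c s] makes [c s c] regular, and a
    regular element of a Peirce corner enlarges the current idempotents. Maximal choices thus force
    the remaining corners of [B'] into the radical ([maximal_regular_element], [left_corner],
    [right_corner], assembled in [inner_ideal_corner]). Bar-minimality turns this congruence into
    [b = e b f] ([bar_minimal_corner]), and [strict_pair_above] enlarges the pair to a strict
    one. *)

Lemma bounded_measure_ascent (T : Type) (P Q : T -> Prop) (m : T -> nat) (N : nat) (t0 : T) :
  P t0 -> (forall t, (m t <= N)%N) ->
  (forall t, P t -> ~ Q t -> exists2 t', P t' & (m t < m t')%N) ->
  exists2 t, P t & Q t.
Proof.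
move=> Pt0 mN step; have [k] := ubnP (N - m t0); elim: k t0 Pt0 => // k IH t Pt.
rewrite ltnS => le_k; have [Qt|nQt] := pselect (Q t); first by exists t.
have [t' Pt' lt_t] := step t Pt nQt; apply: IH Pt' _.
by apply: leq_trans le_k; apply: ltn_sub2l => //; apply: leq_trans (mN t').
Qed.

Lemma min_vspace (F : fieldType) (V : vectType F) (P : {vspace V} -> Prop)
    (U : {vspace V}) :
  P U -> exists W, [/\ P W, (W <= U)%VS &
    forall X, P X -> (X <= W)%VS -> X = W].
Proof.
move=> PU; pose m (W : {vspace V}) := (\dim {:V} - \dim W)%N.
have [|W [PW sWU] minW] := @bounded_measure_ascent {vspace V}
    (fun W => P W /\ (W <= U)%VS) (fun W => forall X, P X -> (X <= W)%VS -> X = W)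
    m (\dim {:V}) U (conj PU (subvv U)) (fun W => leq_subr _ _).
  move=> W [PW sWU] /existsNP[X] /not_implyP[PX] /not_implyP[sXW neq].
  exists X; first by split=> //; apply: subv_trans sWU.
  have lt: (\dim X < \dim W)%N.
    rewrite ltn_neqAle dimvS // andbT; apply/eqP => eq_dim.
    by apply: neq; apply/eqP; rewrite eqEdim sXW eq_dim /=.
  by apply: ltn_sub2l => //; apply: leq_trans lt (dimvS (subvf _)).
by exists W.
Qed.

(** * Idempotents, nilpotency and membership in the radical *)

Section Elements.
Variables (F : fieldType) (A : assocAlgType F).
Implicit Types (x y z e c s : A) (C D I M : {vspace A}).

Lemma amulNl x y : (- x) ** y = - (x ** y).
Proof. by rewrite -!scaleN1r amulZl. Qed.

Lemma amulNr x y : x ** (- y) = - (x ** y).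
Proof. by rewrite -!scaleN1r amulZr. Qed.

Lemma amulBl x y z : (x - y) ** z = x ** z - y ** z.
Proof. by rewrite amulDl amulNl. Qed.

Lemma amulBr x y z : z ** (x - y) = z ** x - z ** y.
Proof. by rewrite amulDr amulNr. Qed.

Definition lmul x : 'Hom(A, A) := linfun (amul x).
Definition rmul x : 'Hom(A, A) := linfun (amul^~ x).

Lemma lmulE x y : lmul x y = x ** y.
Proof.
have lin : linear (amul x) by move=> k u v; rewrite amulDr amulZr.
pose g : {linear A -> A} :=
  HB.pack (amul x) (GRing.isLinear.Build F A A *:%R (amul x) lin).
exact: (lfunE g).
Qed.

Lemma rmulE x y : rmul x y = y ** x.
Proof.
have lin : linear (amul^~ x) by move=> k u v; rewrite amulDl amulZl.
pose g : {linear A -> A} :=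
  HB.pack (amul^~ x) (GRing.isLinear.Build F A A *:%R (amul^~ x) lin).
exact: (lfunE g).
Qed.

Lemma memv_lmulP x C y :
  reflect (exists2 u, u \in C & y = x ** u) (y \in lmul x @: C)%VS.
Proof.
apply: (iffP memv_imgP) => -[u Cu ->]; exists u => //; first by rewrite lmulE.
by rewrite lmulE.
Qed.

Lemma memv_lmul x C u : u \in C -> x ** u \in (lmul x @: C)%VS.
Proof. by move=> Cu; apply/memv_lmulP; exists u. Qed.

Lemma nilpotent_sqr M : nilpotent (mulv M M) -> nilpotent M.
Proof.
case=> n Mn0; exists (n.*2.+1)%N; apply/eqP; rewrite -subv0 -Mn0.
elim: n {Mn0} => [|n IH]; first by rewrite /= subvv.
rewrite doubleS 2!iterS; apply: subv_trans (mulv_sub_assoc _ _ _) _.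
by rewrite [X in (_ <= X)%VS]iterS; apply: mulvS.
Qed.

Lemma idempotent_nilpotent M e :
  nilpotent M -> e \in M -> idempotent e -> e = 0.
Proof.
move=> [n Mn0] Me ee; apply/eqP; rewrite -memv0 -Mn0.
by elim: n {Mn0} => //= n IH; rewrite -ee; apply: memv_amul.
Qed.

(** Take [I] minimal among the right ideals of [M] with [I M] nonzero, and [u] in [I] with [u M]
    nonzero. As [M M = M], the right ideal [u M] qualifies too, so it equals [I] and contains
    [u]. *)
Lemma nonnilpotent_left_unit M :
  mulv M M = M -> M <> 0%VS ->
  exists u m, [/\ u <> 0, m \in M & u = u ** m].
Proof.
move=> MM M0.
pose P I := [/\ (I <= M)%VS, (mulv I M <= I)%VS & mulv I M <> 0%VS].
have PM : P M by split; rewrite ?MM ?subvv.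
have [I [[sIM rI IM] _ minI]] := min_vspace PM.
have [u Iu uM] : exists2 u, u \in I & (lmul u @: M)%VS <> 0%VS.
  apply: contrapT => nex; apply: IM; apply/eqP; rewrite -subv0.
  apply/mulvP=> u y Iu My; rewrite memv0; apply/eqP.
  apply: contrapT => uy0; apply: nex; exists u => // uM0.
  by apply: uy0; apply/eqP; rewrite -memv0 -uM0 memv_lmul.
have uMI : (lmul u @: M)%VS = I.
  apply: minI; last first.
    apply/subvP => _ /memv_lmulP[y My ->].
    exact: (mulvP _ _ _ rI).
  split.
  - apply/subvP => _ /memv_lmulP[y My ->]; apply: (subvP sIM).
    exact: (mulvP _ _ _ rI).
  - apply/mulvP => _ y /memv_lmulP[z Mz ->] My.
    by rewrite -amulA memv_lmul // -MM memv_amul.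
  move=> uMM; apply: uM; apply/eqP; rewrite -subv0 -uMM.
  apply/subvP => _ /memv_lmulP[y My ->].
  have : (mulv M M <= lmul u @^-1: mulv (lmul u @: M) M)%VS.
    apply/mulvP=> v w Mv Mw; rewrite -memv_preim lmulE amulA.
    by apply: memv_amul => //; apply: memv_lmul.
  by rewrite MM => /subvP/(_ y My); rewrite -memv_preim lmulE.
have := Iu; rewrite -uMI => /memv_lmulP[m Mm um].
exists u, m; split=> // u0; apply: uM; apply/eqP; rewrite -subv0.
by apply/subvP=> _ /memv_lmulP[y My ->]; rewrite u0 amul0l mem0v.
Qed.

(** Induction on the dimension: descend to [M M] or to [m M] while one of these is proper. Otherwise
    left multiplication by [m] is bijective on [M], and the solution [v] of [m v = m] is
    idempotent. *)
Lemma nonnilpotent_idempotent M :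
  subalgebra M -> ~ nilpotent M ->
  exists e, [/\ e \in M, idempotent e & e <> 0].
Proof.
have [k] := ubnP (\dim M); elim: k M => // k IH M; rewrite ltnS => le_k algM nM.
have IHM X : (X <= M)%VS -> X <> M -> subalgebra X -> ~ nilpotent X ->
    exists e, [/\ e \in M, idempotent e & e <> 0].
  move=> sXM neq algX nX; have [||//|e [Xe ee e0]] := IH X.
    apply: leq_trans le_k; rewrite ltn_neqAle dimvS // andbT.
    by apply/eqP => eqd; apply: neq; apply/eqP; rewrite eqEdim sXM eqd /=.
  by [].
  by exists e; split=> //; apply: (subvP sXM).
have [MM|/IHM] := pselect (mulv M M = M); last first.
  by apply=> //; [apply: mulvS | move/nilpotent_sqr].
have M0 : M <> 0%VS.
  by move=> M0; apply: nM; exists 0%N.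
have [u [m [u0 Mm um]]] := nonnilpotent_left_unit MM M0.
pose X : {vspace A} := (lmul m @: M)%VS.
have sXM : (X <= M)%VS.
  by apply/subvP => _ /memv_lmulP[y My ->]; rewrite -MM memv_amul.
have nX : ~ nilpotent X.
  case=> n Xn0; apply: u0.
  (* Every power of [X] contains a power of [m m], which fixes the nonzero [u] on the right. *)
  have Xmm : m ** m \in X by apply: memv_lmul.
  have umm : u ** (m ** m) = u by rewrite amulA -!um.
  have [x] : exists2 x, x \in iter n (mulv X) X & u = u ** x.
    elim: n {Xn0} => [|n [x Xx ux]]; first by exists (m ** m).
    exists (m ** m ** x); first by rewrite /= memv_amul.
    by rewrite amulA umm.
  by rewrite Xn0 memv0 => /eqP->; rewrite amul0r.
have [XM|neq] := pselect (X = M); last first.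
  apply: (IHM X) => //; apply/mulvP=> _ _ /memv_lmulP[y My ->] /memv_lmulP[z Mz ->].
  by rewrite -amulA memv_lmul // -MM memv_amul // -MM memv_amul.
have inj : (lker (lmul m) :&: M = 0)%VS.
  have := limg_ker_dim (lmul m) M; rewrite -/X XM => /eqP.
  by rewrite capvC -[X in _ == X]add0n eqn_add2r dimv_eq0 => /eqP.
have := Mm; rewrite -{1}XM => /memv_lmulP[v Mv mv].
have vv : v ** v = v.
  apply/eqP; rewrite -subr_eq0 -memv0 -inj memv_cap memv_ker lmulE amulBr amulA.
  rewrite -!mv subrr eqxx /= memvB //; rewrite -MM; exact: memv_amul.
exists v; split=> // v0; apply: u0; rewrite um mv v0 !amul0r //.
Qed.

(* The right ideal [c C] contains no nonzero idempotent.  The condition is    *)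
(* left-right symmetric, and implies that [c] is in the radical of [C].       *)
Definition quasinil C c := forall s, s \in C -> idempotent (c ** s) -> c ** s = 0.

Lemma quasinil_rad C c :
  subalgebra C -> c \in C -> quasinil C c -> c \in rad C.
Proof.
move=> algC Cc qc; have /mulvP CC := algC.
(* The right ideal generated by [c]; the line through [c] is added because [C] may lack an
   identity. *)
pose D : {vspace A} := (<[c]> + lmul c @: C)%VS.
have Dc : c \in D by rewrite (subvP (addvSl _ _)) ?memv_line.
have Dcs s : s \in C -> c ** s \in D.
  by move=> Cs; apply: (subvP (addvSr _ _)); apply: memv_lmul.
have DC : (mulv D C <= D)%VS.
  apply/mulvP => _ s /memv_addP[_ /vlineP[k ->] [_ /memv_lmulP[y Cy ->] ->]] Cs.
  by rewrite amulDl amulZl memvD ?memvZ ?Dcs // -amulA Dcs ?CC.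
have sDC : (D <= C)%VS.
  rewrite subv_add -memvE Cc; apply/subvP => _ /memv_lmulP[y Cy ->]; exact: CC.
have nD : nilpotent D.
  apply: contrapT => nD.
  have [|e [De ee]] := nonnilpotent_idempotent _ nD.
    by apply: subv_trans DC; apply: mulvS.
  have [_ /vlineP[k ->] [_ /memv_lmulP[y Cy ->] eE]] := memv_addP De.
  have Ce : e \in C by apply: (subvP sDC).
  (* Multiplying [e = k c + c y] by [e] absorbs the scalar term into a multiple [c s] with [s] in
     [C]. *)
  have ecs : e = c ** (k *: e + y ** e).
    by rewrite -{1}ee {1}eE amulDl amulDr amulZl amulZr amulA.
  by rewrite ecs => -[]; apply: qc; rewrite -?ecs // memvD ?memvZ ?CC.
pose T : {vspace A} := (D + mulv C D)%VS.
have sCDC : (mulv C D <= C)%VS by apply: subv_trans algC; apply: mulvS.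
have CT X : (mulv C (mulv C X) <= mulv C X)%VS.
  by apply: subv_trans (mulv_sub_assoc _ _ _) _; apply: mulvS.
have idT : ideal C T.
  apply/and3P; split; first by rewrite subv_add sDC.
    apply/mulvP => x _ Cx /memv_addP[u Du [v Dv ->]].
    rewrite amulDr [X in X \in _]addrC; apply: memvD; apply: (subvP (addvSr _ _)).
      by apply: (subvP (CT _)); apply: memv_amul.
    exact: memv_amul.
  apply/mulvP => _ x /memv_addP[u Du [v Dv ->]] Cx.
  rewrite amulDl memv_add ?(mulvP _ _ _ DC) //.
  have : (mulv C D <= rmul x @^-1: mulv C D)%VS.
    apply/mulvP => y z Cy Dz; rewrite -memv_preim rmulE -amulA memv_amul //.
    exact: (mulvP _ _ _ DC).
  by move/subvP/(_ v Dv); rewrite -memv_preim rmulE.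
have [_ _ radC] := radP C; apply: (subvP (radC T idT _)).
  have [n Dn0] := nD; exists n; apply/eqP; rewrite -subv0.
  (* Since [D C] lies in [D], factors from [C] inside a product are absorbed; only a leading one
     survives. *)
  have : (iter n (mulv T) T <= iter n (mulv D) D + mulv C (iter n (mulv D) D))%VS.
    elim: n {Dn0} => //= n IH; set X := iter n _ D in IH *.
    apply: subv_trans (mulvS (subvv T) IH) _.
    have DCX : (mulv D (X + mulv C X) <= mulv D X)%VS.
      apply/mulvP => d _ Dd /memv_addP[u Xu [v CXv ->]].
      rewrite amulDr; apply: memvD; first exact: memv_amul.
      apply: (subvP (mulvS DC (subvv X))); apply: (subvP (mulv_sub_assoc _ _ _)).
      exact: memv_amul.
    apply/mulvP => _ w /memv_addP[u Du [v CDv ->]] Xw.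
    rewrite amulDl memv_add //; first by apply: (subvP DCX); apply: memv_amul.
    have : (mulv C D <= rmul w @^-1: mulv C (mulv D X))%VS.
      apply/mulvP => y z Cy Dz; rewrite -memv_preim rmulE -amulA memv_amul //.
      by apply: (subvP DCX); apply: memv_amul.
    by move/subvP/(_ v CDv); rewrite -memv_preim rmulE.
  rewrite Dn0 add0v => /subv_trans; apply.
  by apply/mulvP => x y _; rewrite !memv0 => /eqP->; rewrite amul0r.
by apply: (subvP (addvSl _ _)).
Qed.

(** If [c s] is idempotent, so is [s c s c], a left multiple of [c]; it vanishes, hence so does
    [c s = c (s c s c) s]. *)
Lemma quasinil_left C c :
  subalgebra C -> c \in C ->
  (forall s, s \in C -> idempotent (s ** c) -> s ** c = 0) -> quasinil C c.
Proof.
move=> /mulvP CC Cc qc s Cs; rewrite /Defs.idempotent => cs_idem.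
have scsc0 : s ** c ** s ** c = 0.
  apply: (qc (s ** c ** s)); first by rewrite !CC.
  rewrite /Defs.idempotent; have <- : s ** (c ** s ** (c ** s) ** (c ** s)) ** c =
    s ** c ** s ** c ** (s ** c ** s ** c) by rewrite !amulA.
  by rewrite !cs_idem !amulA.
have -> : c ** s = c ** (s ** c ** s ** c) ** s.
  by rewrite -{1}cs_idem -{1}cs_idem !amulA.
by rewrite scsc0 amul0r amul0l.
Qed.

(* The corners need no identity element: [e ** c = 0] and [c ** f = 0] say    *)
(* that [c] lies in [(1 - e) C (1 - f)].                                      *)
Lemma regular_multiple C e f c :
  subalgebra C -> e \in C -> f \in C -> c \in C ->
  idempotent e -> idempotent f -> e ** c = 0 -> c ** f = 0 ->
  ~ quasinil C c ->
  exists t z, let c' := c ** t ** c in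
    [/\ t \in C, z \in C, c' ** z ** c' = c', z ** c' ** z = z & c' <> 0]
    /\ f ** z = 0 /\ z ** e = 0.
Proof.
move=> /mulvP CC Ce Cf Cc ee ff ec cf /existsNP[s] /not_implyP[Cs].
case/not_implyP=> vv v0.
pose c' := c ** s ** c; pose z0 := s ** (c ** s).
have c'z0 : c' ** z0 = c ** s by rewrite /c' /z0 -amulA [c ** (s ** _)]amulA !vv.
have z0c' : z0 ** c' ** z0 = z0 by rewrite -amulA c'z0 /z0 -amulA vv.
have c'f : c' ** f = 0 by rewrite /c' -amulA cf amul0r.
have ec' : e ** c' = 0 by rewrite /c' !amulA ec !amul0l.
(* This is [(1 - f) z0 (1 - e)]: the inverse [z0] of [c'] is cut down to the corner opposite to that
   of [c']. *)
pose z := z0 - f ** z0 - (z0 - f ** z0) ** e.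
have c'z : c' ** z = c ** s - c ** s ** e.
  by rewrite /z amulBr [c' ** (_ ** e)]amulA !amulBr amulA c'f amul0l subr0 c'z0.
have zc' : z ** c' = z0 ** c' - f ** (z0 ** c').
  by rewrite /z amulBl -[_ ** e ** c']amulA ec' amul0r subr0 amulBl amulA.
exists s, z; split; last split; first split=> //.
- by rewrite !(memvB, CC).
- by rewrite c'z amulBl -[_ ** e ** _]amulA ec' amul0r subr0 amulA vv.
- rewrite zc' /z amulBr [_ ** (_ ** e)]amulA.
  suff -> : (z0 ** c' - f ** (z0 ** c')) ** (z0 - f ** z0) = z0 - f ** z0 by [].
  rewrite amulBr !amulBl -![f ** _ ** _]amulA -![z0 ** c' ** (f ** _)]amulA.
  by rewrite [c' ** (f ** _)]amulA c'f !(amul0l, amul0r) !subr0 z0c'.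
- by move=> c'0; apply: v0; rewrite -c'z0 [c']c'0 amul0l.
- have fw : f ** (z0 - f ** z0) = 0 by rewrite amulBr amulA ff subrr.
  by rewrite /z amulBr amulA fw amul0l subr0.
by rewrite /z amulBl -amulA ee subrr.
Qed.

(** The right ideal [e' C] contains [e C] and also [g], which [e] kills. This strict growth drives
    the maximality arguments. *)
Lemma corner_dim C e e' g :
  subalgebra C -> e \in C -> g \in C -> idempotent e ->
  e' ** e = e -> e' ** g = g -> e ** g = 0 -> g <> 0 ->
  (\dim (lmul e @: C) < \dim (lmul e' @: C))%N.
Proof.
move=> /mulvP CC Ce Cg ee e'e e'g eg g0.
have sub : (lmul e @: C <= lmul e' @: C)%VS.
  apply/subvP => _ /memv_lmulP[y Cy ->].
  by rewrite -e'e -amulA memv_lmul // CC.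
rewrite ltn_neqAle dimvS // andbT; apply/eqP => eq_dim.
have /eqP eqe : (lmul e @: C == lmul e' @: C)%VS by rewrite eqEdim sub eq_dim /=.
have : g \in (lmul e' @: C)%VS by rewrite -e'g memv_lmul.
by rewrite -eqe => /memv_lmulP[y _ gy]; apply: g0; rewrite -eg gy amulA ee.
Qed.

(** * Enlarging Peirce corners inside an inner ideal *)

Section InnerIdeal.
Variables (C B : {vspace A}).
Hypotheses (algC : subalgebra C) (sBC : (B <= C)%VS).
Hypothesis innerB : forall b x, b \in B -> x \in C -> b ** x ** b \in B.
Hypothesis innerB2 : forall a b x, a \in B -> b \in B -> x \in C ->
  a ** x ** b + b ** x ** a \in B.

Lemma maximal_regular_element :
  exists a x, [/\ a \in B, x \in C, a ** x ** a = a, x ** a ** x = x &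
    forall b, b \in B ->
      quasinil C (b - a ** x ** b - (b - a ** x ** b) ** (x ** a))].
Proof using algC sBC innerB innerB2.
have /mulvP CC := algC; have BC := subvP sBC.
pose P (p : A * A) := [/\ p.1 \in B, p.2 \in C, p.1 ** p.2 ** p.1 = p.1 &
  p.2 ** p.1 ** p.2 = p.2].
pose Q (p : A * A) := forall b, b \in B -> quasinil C
  (b - p.1 ** p.2 ** b - (b - p.1 ** p.2 ** b) ** (p.2 ** p.1)).
pose m (p : A * A) := \dim (lmul (p.1 ** p.2) @: C).
have P0 : P (0, 0) by split; rewrite /= ?mem0v // !amul0l.
have mA p : (m p <= \dim {:A})%N by apply: dimvS; apply: subvf.
have [[a x] Pax nQ|[a x] [/= Ba Cx axa xax] Qax] :=
  @bounded_measure_ascent _ P Q m _ _ P0 mA; last first.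
  by exists a, x.
case: Pax nQ => /= Ba Cx axa xax /existsNP[b] /not_implyP[Bb].
set e := a ** x; set f := x ** a; set c := (X in quasinil C X) => nc.
have Ca := BC a Ba; have Cb := BC b Bb.
have Ce : e \in C by apply: CC.
have Cf : f \in C by apply: CC.
have ee : e ** e = e by rewrite /e amulA axa.
have ff : f ** f = f by rewrite /f amulA xax.
have ea : e ** a = a by [].
have af : a ** f = a by rewrite /f amulA.
have xe : x ** e = x by rewrite /e amulA.
have fx : f ** x = x by [].
(* Here [c = b - (a x b + b x a) + a (x b x) a], and each summand is in [B]. *)
have Bc : c \in B.
  have -> : c = b - (e ** b + b ** f) + a ** (x ** b ** x) ** a.
    by rewrite /c amulBl opprB /e /f !amulA opprD !addrA addrAC.
  rewrite memvD ?memvB //; last by apply: innerB; rewrite ?CC.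
  by rewrite /f amulA; apply: innerB2.
have Cc := BC c Bc.
have ec : e ** c = 0.
  rewrite /c amulBr [e ** (_ ** f)]amulA amulBr [e ** (e ** b)]amulA ee subrr.
  by rewrite amul0l subr0.
have cf : c ** f = 0 by rewrite /c amulBl -amulA ff subrr.
have [t [z [[Ct Cz]]]] := regular_multiple algC Ce Cf Cc ee ff ec cf nc.
have : c ** t ** c \in B by apply: innerB.
have : (c ** t ** c) ** f = 0 by rewrite -amulA cf amul0r.
have : e ** (c ** t ** c) = 0 by rewrite !amulA ec !amul0l.
set c' := c ** t ** c => ec' c'f Bc' c'zc' zc'z c'0 [fz ze].
have az : a ** z = 0 by rewrite -af -amulA fz amul0r.
have c'x : c' ** x = 0 by rewrite -fx amulA c'f amul0l.
have za : z ** a = 0 by rewrite -ea amulA ze amul0l.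
have xc' : x ** c' = 0 by rewrite -xe -amulA ec' amul0r.
(* The pairs [(a, x)] and [(c', z)] are orthogonal, so their sum is again a regular pair. *)
have E : (a + c') ** (x + z) = e + c' ** z.
  by rewrite amulDl !amulDr az c'x addr0 add0r.
have E' : (x + z) ** (a + c') = f + z ** c'.
  by rewrite amulDl !amulDr za xc' addr0 add0r.
exists (a + c', x + z); first split; rewrite /= ?memvD //.
- rewrite E amulDl !amulDr ea ec' addr0 c'zc' -[_ ** z ** a]amulA za amul0r.
  by rewrite add0r.
- rewrite E' amulDl !amulDr fx fz addr0 zc'z -[_ ** c' ** x]amulA c'x amul0r.
  by rewrite add0r.
rewrite /m /= E -/e; apply: (corner_dim (g := c' ** z)) => //.
- by rewrite CC // BC.
- by rewrite amulDl ee -amulA [z ** e]ze amul0r addr0.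
- by rewrite amulDl amulA ec' amul0l add0r amulA c'zc'.
- by rewrite amulA ec' amul0l.
by move=> c'z; apply: c'0; rewrite -c'zc' c'z amul0l.
Qed.

(* In Peirce terms, [c = e0 b (1 - f)] for a current [f] satisfies that       *)
(* [c y c] is in [B] for all [y], so that a regular multiple of [c] that is   *)
(* in [B] yields an idempotent [g] with [e C g] in [B] orthogonal to [f].     *)
Lemma right_corner a x e :
  a \in B -> x \in C -> a ** x ** a = a -> x ** a ** x = x ->
  e \in C -> e ** (a ** x) = a ** x ->
  (forall y, y \in C -> e ** y ** (x ** a) \in B) ->
  exists f, [/\ f \in C, idempotent f, f ** (x ** a) = x ** a & x ** a ** f = x ** a]
    /\ (forall y, y \in C -> e ** y ** f \in B) /\
    forall b, b \in B -> quasinil C (a ** x ** b - a ** x ** b ** f).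
Proof using algC sBC innerB innerB2.
move=> Ba Cx axa xax Ce; have /mulvP CC := algC; have BC := subvP sBC.
set e0 := a ** x; set f0 := x ** a => ee0 eCf0.
pose P f := [/\ f \in C, idempotent f, f ** f0 = f0 & f0 ** f = f0]
    /\ forall y, y \in C -> e ** y ** f \in B.
pose Q f := forall b, b \in B -> quasinil C (e0 ** b - e0 ** b ** f).
pose m f := \dim (lmul f @: C).
have Ca := BC a Ba.
have Ce0 : e0 \in C by apply: CC.
have Cf0 : f0 \in C by apply: CC.
have e0e0 : e0 ** e0 = e0 by rewrite /e0 amulA axa.
have f0f0 : f0 ** f0 = f0 by rewrite /f0 amulA xax.
have e0E : a ** x = e0 by [].
have f0E : x ** a = f0 by [].
clearbody e0 f0.
have mA f : (m f <= \dim {:A})%N by apply: dimvS; apply: subvf.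
have P0 : P f0 by [].
have [f [[Cf ff ff0 f0f] eCf] nQ|f [Pf eCf] Qf] :=
  @bounded_measure_ascent _ P Q m _ _ P0 mA; last first.
  by exists f.
case/existsNP: nQ => b /not_implyP[Bb]; set c := (X in quasinil C X) => nc.
have Cb := BC b Bb.
have cf : c ** f = 0 by rewrite /c amulBl -[_ ** f ** f]amulA ff subrr.
have e0c : e0 ** c = c by rewrite /c amulBr !amulA e0e0.
have Cc : c \in C by rewrite memvB ?CC.
have cCc y : y \in C -> c ** y ** c \in B.
  (* The inner ideal contains only the sum of the mixed components [d = e0 b (1 - f0)] and
     [h = (1 - e0) b f0]. Taking [y1 = (1 - f) y e0] kills every term of [(d + h) y1 (d + h)] except
     [d y1 d]. *)
  move=> Cy; pose d := e0 ** b - e0 ** b ** f0.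
  pose h := b ** f0 - e0 ** b ** f0.
  pose y1 := y ** e0 - f ** y ** e0.
  have Bdh : d + h \in B.
    have -> : d + h = e0 ** b + b ** x ** a - e0 ** b ** f0 - e0 ** b ** f0.
      by rewrite /d /h -[b ** x ** a]amulA f0E addrACA -opprD -!addrA opprD.
    have Bebf : e0 ** b ** f0 \in B.
      have -> : e0 ** b ** f0 = a ** (x ** b ** x) ** a by rewrite -e0E -f0E !amulA.
      by apply: innerB; rewrite ?CC.
    by rewrite !memvB // -e0E innerB2.
  have hy1 : h ** y1 = 0.
    have -> : h = h ** f0 by rewrite /h amulBl -!amulA f0f0.
    rewrite -amulA /y1 amulBr !amulA [f0 ** f]f0f subrr amul0r //.
  have y1h : y1 ** h = 0.
    have -> : y1 = y1 ** e0 by rewrite /y1 amulBl -!amulA e0e0.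
    by rewrite -amulA /h amulBr !amulA e0e0 subrr amul0r.
  have Cy1 : y1 \in C by rewrite memvB ?CC.
  have Bd : d ** y1 ** d \in B.
    have := innerB Bdh Cy1.
    by rewrite amulDl hy1 addr0 amulDr -[d ** y1 ** h]amulA y1h amul0r addr0.
  have ed : e ** d = d by rewrite /d amulBr !amulA ee0.
  have dc : c = d - d ** f.
    by rewrite /c /d amulBl -[_ ** f0 ** f]amulA f0f opprB addrA addrNK.
  have -> : c ** y ** c = d ** y1 ** d - e ** (d ** y1 ** d) ** f.
    rewrite !amulA ed -[_ ** d ** f]amulA -amulBr -dc -{2 3}e0c !amulA; congr (_ ** c).
    by rewrite dc /y1 !(amulBr, amulBl) !amulA -![_ ** e0 ** e0]amulA e0e0.
  rewrite memvB // eCf // BC //.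
have [t [z1 [[Ct Cz1]]]] :=
  regular_multiple algC (mem0v C) Cf Cc (amul0l 0) ff (amul0l c) cf nc.
have : c ** t ** c \in B by apply: cCc.
have : (c ** t ** c) ** f = 0 by rewrite -amulA cf amul0r.
have : e0 ** (c ** t ** c) = c ** t ** c by rewrite !amulA e0c.
set c' := c ** t ** c => e0c' c'f Bc' c'zc' zc'z c'0 [fz1 _]; clearbody c'.
pose z := z1 ** e0.
have fz : f ** z = 0 by rewrite /z amulA fz1 amul0l.
have zc' : z ** c' = z1 ** c' by rewrite /z -amulA e0c'.
have c'zc'' : c' ** z ** c' = c' by rewrite -amulA zc' amulA.
have gg : z ** c' ** (z ** c') = z ** c' by rewrite amulA zc' /z !amulA zc'z -amulA e0c'.
set g := z ** c' in gg.
have fg : f ** g = 0 by rewrite /g amulA fz amul0l.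
have gf : g ** f = 0 by rewrite /g -amulA c'f amul0r.
have Cg : g \in C by rewrite /g /z !CC // BC.
have c'f0 : c' ** f0 = 0 by rewrite -ff0 amulA c'f amul0l.
exists (f + g); first split; first split.
- exact: memvD.
- by rewrite /Defs.idempotent amulDl !amulDr [f ** f]ff fg gf gg addr0 add0r.
- by rewrite amulDl ff0 -amulA c'f0 amul0r addr0.
- by rewrite amulDr f0f -f0f -amulA fg amul0r addr0.
- move=> y Cy; rewrite amulDr memvD ?eCf //.
  have Bp : e ** y ** z ** a \in B.
    have -> : e ** y ** z ** a = e ** (y ** z ** a) ** f0.
      rewrite -f0E -[RHS]amulA -[_ ** a ** (_ ** _)]amulA [a ** (x ** a)]amulA.
      by rewrite axa !amulA.
    by rewrite eCf0 // /z !CC.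
  (* The second summand is zero; it is inserted so that [innerB2] applies to [e y z a] and [c']. *)
  have -> : e ** y ** g = e ** y ** z ** a ** x ** c' + c' ** x ** (e ** y ** z ** a).
    have c'x : c' ** x = 0 by rewrite -xax f0E amulA c'f0 amul0l.
    rewrite c'x amul0l addr0 -[_ ** a ** x]amulA e0E -[_ ** e0 ** c']amulA e0c'.
    by rewrite /g !amulA.
  exact: innerB2.
apply: (corner_dim (g := g)) => //.
- by rewrite amulDl [f ** f]ff gf addr0.
- by rewrite amulDl fg gg add0r.
by move=> g0; apply: c'0; rewrite -c'zc'' -amulA -/g g0 amul0r.
Qed.

End InnerIdeal.

End Elements.

(** * The opposite algebra, a synonym of [A], so that both algebras share their subspaces *)

Definition opposite (F : fieldType) (A : assocAlgType F) : Type := A.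
HB.instance Definition _ (F : fieldType) (A : assocAlgType F) :=
  Vector.on (opposite A).

Section Opposite.
Variables (F : fieldType) (A : assocAlgType F).

Definition opp_mul (x y : opposite A) : opposite A := (y : A) ** (x : A).

Let opp_mulA : associative opp_mul.
Proof. by move=> x y z; rewrite /opp_mul amulA. Qed.
Let opp_mulDl : left_distributive opp_mul +%R.
Proof. by move=> x y z; apply: amulDr. Qed.
Let opp_mulDr : right_distributive opp_mul +%R.
Proof. by move=> x y z; apply: amulDl. Qed.
Let opp_mulZl (k : F) x y : opp_mul (k *: x) y = k *: opp_mul x y.
Proof. exact: amulZr. Qed.
Let opp_mulZr (k : F) x y : opp_mul x (k *: y) = k *: opp_mul x y.
Proof. exact: amulZl. Qed.

HB.instance Definition _ := Vector_isAssocAlg.Build F (opposite A)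
  opp_mulA opp_mulDl opp_mulDr opp_mulZl opp_mulZr.

Lemma opp_mulE (x y : opposite A) : x ** y = (y : A) ** (x : A) :> A.
Proof. by []. Qed.

Lemma subalgebra_opposite (C : {vspace A}) :
  subalgebra C -> @subalgebra F (opposite A) C.
Proof. by move/mulvP=> CC; apply/mulvP=> x y Cx Cy; apply: CC. Qed.

Lemma quasinil_opposite (C : {vspace A}) (c : A) :
  subalgebra C -> c \in C -> @quasinil F (opposite A) C c -> quasinil C c.
Proof. by move=> algC Cc qc; apply: quasinil_left. Qed.

End Opposite.

Section InnerIdealIdempotents.
Variables (F : fieldType) (A : assocAlgType F) (C B : {vspace A}).
Hypotheses (algC : subalgebra C) (sBC : (B <= C)%VS).
Hypothesis innerB : forall b x, b \in B -> x \in C -> b ** x ** b \in B.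
Hypothesis innerB2 : forall a b x, a \in B -> b \in B -> x \in C ->
  a ** x ** b + b ** x ** a \in B.

(** This is [right_corner] in the opposite algebra, where [a x] and [x a] trade places; the
    idempotent held fixed is [x a] itself. *)
Lemma left_corner a x :
  a \in B -> x \in C -> a ** x ** a = a -> x ** a ** x = x ->
  exists e, [/\ e \in C, idempotent e & e ** (a ** x) = a ** x]
    /\ (forall y, y \in C -> e ** y ** (x ** a) \in B) /\
    forall b, b \in B -> quasinil C (b ** (x ** a) - e ** b ** (x ** a)).
Proof using algC sBC innerB innerB2.
move=> Ba Cx axa xax; have /mulvP CC := algC; have BC := subvP sBC.
have Ca := BC a Ba.
have [|||||||e [[Ce ee _ fe] [eCf qe]]] := @right_corner F (opposite A) C B
    (subalgebra_opposite algC) sBC _ _ a x (x ** a : A) Ba Cx.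
- by move=> b y Bb Cy; rewrite !opp_mulE amulA; apply: innerB.
- by move=> b c y Bb Bc Cy; rewrite !opp_mulE !amulA addrC; apply: innerB2.
- by rewrite !opp_mulE amulA.
- by rewrite !opp_mulE amulA.
- exact: CC.
- by rewrite !opp_mulE !amulA xax.
- move=> y Cy; have := innerB Ba (CC _ _ (CC _ _ Cx Cy) Cx).
  by rewrite !opp_mulE !amulA.
exists e; split; first split.
- by [].
- by [].
- by [].
split.
  by move=> y Cy; have := eCf y Cy; rewrite !opp_mulE !amulA.
move=> b Bb; apply: quasinil_opposite => //.
  have Cb : b \in C := BC b Bb.
  by apply: memvB; rewrite !CC.
by have := qe b Bb; rewrite !opp_mulE !amulA.
Qed.

Lemma inner_ideal_corner :
  exists e f, [/\ e \in C, f \in C, idempotent e, idempotent f &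
    (forall y, y \in C -> e ** y ** f \in B) /\
    forall b, b \in B -> b - e ** b ** f \in rad C].
Proof using algC sBC innerB innerB2.
have /mulvP CC := algC; have BC := subvP sBC.
have [a [x [Ba Cx axa xax qb]]] := maximal_regular_element algC sBC innerB innerB2.
have [e [[Ce ee eax] [eCf qe]]] := left_corner Ba Cx axa xax.
have [f [[Cf ff fxa xaf] [eCf' qf]]] :=
  right_corner algC sBC innerB innerB2 Ba Cx axa xax Ce eax eCf.
have Ca := BC a Ba.
exists e, f; split=> //; split=> // b Bb; have Cb := BC b Bb.
have R C1 : C1 \in C -> quasinil C C1 -> C1 \in rad C.
  by move=> ? ?; apply: quasinil_rad.
have [/and3P[_ /mulvP lR /mulvP rR] _ _] := radP C.
set e0 := a ** x in eax qb qe qf *; set f0 := x ** a in qb qe qf fxa xaf eCf *.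
have Ce0 : e0 \in C by apply: CC.
have Cf0 : f0 \in C by apply: CC.
clearbody e0 f0.
have R0 : b - e0 ** b - (b - e0 ** b) ** f0 \in rad C.
  by apply: R (qb b Bb); rewrite !(memvB, CC).
have R1 : b ** f0 - e ** b ** f0 \in rad C.
  by apply: R (qe b Bb); rewrite !(memvB, CC).
have R2 : e0 ** b - e0 ** b ** f \in rad C.
  by apply: R (qf b Bb); rewrite !(memvB, CC).
have R3 : e ** (b - e0 ** b - (b - e0 ** b) ** f0) ** f \in rad C.
  by apply: (rR) => //; apply: lR.
(* With [r = (1 - e0) b (1 - f0)], the element [b - e b f] is
   [r - e r f + (1 - e) b f0 + e0 b (1 - f)], as [e e0 = e0] and [f0 f = f0]. *)
have <- : (b - e0 ** b - (b - e0 ** b) ** f0)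
  - e ** (b - e0 ** b - (b - e0 ** b) ** f0) ** f
  + (b ** f0 - e ** b ** f0) + (e0 ** b - e0 ** b ** f) = b - e ** b ** f.
  rewrite !(amulBl, amulBr) !amulA eax -![_ ** f0 ** f]amulA xaf.
  rewrite !opprB !addrA.
  by rewrite [LHS](ACl (1*8*11*2*3*6*9*4*5*10*7*12)) /= !addrK.
by apply: memvD R2; apply: memvD R1; apply: memvB.
Qed.

End InnerIdealIdempotents.

(** * One-sided identities modulo the radical *)

Section IdentityModRadical.
Variables (F : fieldType) (A : assocAlgType F).
Implicit Types (D : {vspace A}) (e f : A).

Lemma subalgebra_full : subalgebra {:A}%VS.
Proof. exact: subvf. Qed.

(** Choose [e'] with [e' A] of maximal dimension. A nonzero idempotent [v = (a - e' a) s] would give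
    the idempotent [E = v (1 - e')], nonzero and orthogonal to [e'], and [e' + E] would be
    larger. *)
Lemma left_identity_above D e :
  (mulv D {:A} <= D)%VS -> e \in D -> idempotent e ->
  exists e', [/\ e' \in D, idempotent e', e' ** e = e &
    forall a, a \in D -> quasinil {:A}%VS (a - e' ** a)].
Proof.
move=> /mulvP DA De ee.
pose P e' := [/\ e' \in D, idempotent e' & e' ** e = e].
pose Q e' := forall a, a \in D -> quasinil {:A}%VS (a - e' ** a).
pose m e' := \dim (lmul e' @: {:A}).
have mA e' : (m e' <= \dim {:A})%N by apply: dimvS; apply: subvf.
have P0 : P e by [].
have [e' [De' ee' e'e] nQ|e' [De' ee' e'e] Qe'] :=
  @bounded_measure_ascent _ P Q m _ _ P0 mA; last first.
  by exists e'.
case/existsNP: nQ => a /not_implyP[Da] /existsNP[s] /not_implyP[_].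
case/not_implyP; set v := _ ** s => vv v0.
have Dv : v \in D by apply: (DA); rewrite ?memvf // memvB // DA ?memvf.
have e'v : e' ** v = 0 by rewrite amulA amulBr amulA ee' subrr amul0l.
clearbody v; pose E := v - v ** e'.
have e'E : e' ** E = 0 by rewrite amulBr amulA e'v amul0l subr0.
have Ee' : E ** e' = 0 by rewrite amulBl -amulA ee' subrr.
have Ev : E ** v = v by rewrite amulBl vv -amulA e'v amul0r subr0.
have EE : E ** E = E by rewrite {2}/E amulBr amulA Ev.
have DE : E \in D by rewrite memvB // DA ?memvf.
clearbody E.
exists (e' + E); first split.
- exact: memvD.
- by rewrite /Defs.idempotent amulDl !amulDr ee' e'E Ee' EE addr0 add0r.
- by rewrite amulDl e'e -e'e amulA Ee' amul0l addr0.
apply: (corner_dim (g := E)); rewrite ?memvf //.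
- exact: subalgebra_full.
- by rewrite amulDl ee' Ee' addr0.
- by rewrite amulDl e'E EE add0r.
by move=> E0; apply: v0; rewrite -Ev E0 amul0l.
Qed.

End IdentityModRadical.

Lemma right_identity_above (F : fieldType) (A : assocAlgType F)
    (D : {vspace A}) (f : A) :
  (mulv {:A} D <= D)%VS -> f \in D -> idempotent f ->
  exists f', [/\ f' \in D, idempotent f', f ** f' = f &
    forall a, a \in D -> quasinil {:A}%VS (a - a ** f')].
Proof.
move=> /mulvP AD Df ff.
have [||f' [Df' ff' f'f qf']] := @left_identity_above F (opposite A) D f _ Df.
- by apply/mulvP => x y Dx _; apply: AD; rewrite ?memvf.
- exact: ff.
exists f'; split=> // a Da; apply: quasinil_opposite; rewrite ?memvf //.
  exact: subalgebra_full.
exact: qf'.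
Qed.

(** * Decomposition of an algebra with zero radical into simple ideals *)

Section Semisimple.
Variables (F : fieldType) (Q : assocAlgType F).
Hypothesis radQ : rad {:Q}%VS = 0%VS.
Implicit Types (I J K : {vspace Q}).

Lemma semisimple_quasinil (c : Q) : quasinil {:Q}%VS c -> c = 0.
Proof using radQ.
move=> qc; apply/eqP; rewrite -memv0 -radQ.
by apply: quasinil_rad; rewrite ?memvf ?subalgebra_full.
Qed.

(** A left identity [e] and a right identity [f] of [I] coincide, and [e x = e x e = x e] because
    [e x] and [x e] lie in [I]. *)
Lemma ideal_identity I : ideal {:Q}%VS I ->
  exists e, [/\ e \in I, forall a, a \in I -> e ** a = a,
    forall a, a \in I -> a ** e = a & forall x, e ** x = x ** e].
Proof using radQ.
case/and3P=> _ lI rI.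
have idem0 : idempotent (0 : Q) by apply: amul0l.
have [e [Ie ee _ qe]] := left_identity_above rI (mem0v I) idem0.
have [f [If ff _ qf]] := right_identity_above lI (mem0v I) idem0.
have eK a : a \in I -> e ** a = a.
  by move=> Ia; apply/esym/eqP; rewrite -subr_eq0; apply/eqP/semisimple_quasinil/qe.
have fK a : a \in I -> a ** f = a.
  by move=> Ia; apply/esym/eqP; rewrite -subr_eq0; apply/eqP/semisimple_quasinil/qf.
have fe : f = e by rewrite -(fK e) ?eK.
rewrite {}fe in fK; exists e; split=> // x.
rewrite -[LHS]fK; last by apply: (mulvP _ _ _ rI); rewrite ?memvf.
by rewrite -amulA eK //; apply: (mulvP _ _ _ lI); rewrite ?memvf.
Qed.

(** The complement is the annihilator in [I] of the central identity [e] of [J], through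
    [x = e x + (x - e x)]. *)
Lemma ideal_complement I J :
  ideal {:Q}%VS I -> ideal {:Q}%VS J -> (J <= I)%VS ->
  exists K, [/\ ideal {:Q}%VS K, (J + K)%VS = I & (J :&: K)%VS = 0%VS].
Proof using radQ.
move=> idI idJ sJI; have [e [Je eJ _ eZ]] := ideal_identity idJ.
case/and3P: idI => _ /mulvP lI /mulvP rI.
case/and3P: idJ => _ _ /mulvP rJ.
have memK x : (x \in (I :&: lker (lmul e))%VS) = (x \in I) && (e ** x == 0).
  by rewrite memv_cap memv_ker lmulE.
exists (I :&: lker (lmul e))%VS; split.
- apply/and3P; split; first exact: subvf.
    apply/mulvP => x y _; rewrite !memK => /andP[Iy /eqP ey].
    by rewrite lI ?memvf //= amulA eZ -amulA ey amul0r.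
  apply/mulvP => x y; rewrite !memK => /andP[Ix /eqP ex] _.
  by rewrite rI ?memvf //= amulA ex amul0l.
- apply/eqP; rewrite eqEsubv subv_add sJI capvSl /=.
  apply/subvP => x Ix; have Jex : e ** x \in J by apply: rJ; rewrite ?memvf.
  rewrite -[x](subrK (e ** x)) addrC memv_add // memK.
  by rewrite memvB // ?(subvP sJI) //= amulBr (eJ _ Jex) subrr.
apply/eqP; rewrite -subv0; apply/subvP => x.
by rewrite memv_cap memK memv0 => /and3P[Jx _]; rewrite eJ.
Qed.

(** Ideals of [I] are ideals of [Q]: for [y] in such an ideal, [x y = (x e) y] with [x e] in [I],
    and likewise on the right. *)
Lemma minimal_ideal_simple I :
  ideal {:Q}%VS I -> I <> 0%VS ->
  (forall J, ideal {:Q}%VS J -> J <> 0%VS -> (J <= I)%VS -> J = I) ->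
  simple_alg I.
Proof using radQ.
move=> idI I0 minI; have [e [Ie eI Ie1 eZ]] := ideal_identity idI.
case/and3P: idI => _ /mulvP lI /mulvP rI.
split=> [II0|J /and3P[sJI /mulvP lJ /mulvP rJ]].
  apply: I0; apply/eqP; rewrite -subv0 -II0; apply/subvP => x Ix.
  by rewrite -(eI x Ix) memv_amul.
have [->|J0] := pselect (J = 0%VS); [by left | right].
apply: minI => //; apply/and3P; split; first exact: subvf.
  apply/mulvP => x y _ Jy; rewrite -(eI y) ?(subvP sJI) // amulA lJ //.
  by rewrite lI ?memvf.
apply/mulvP => x y Jx _; rewrite -(Ie1 x) ?(subvP sJI) // -amulA rJ //.
by rewrite rI ?memvf.
Qed.

Lemma ideal_decomposition I : ideal {:Q}%VS I ->
  exists s : seq {vspace Q}, [/\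
    forall X, X \in s -> ideal {:Q}%VS X /\ simple_alg X,
    (\sum_(X <- s) X)%VS = I & \dim I = (\sum_(X <- s) \dim X)%N].
Proof using radQ.
have [k] := ubnP (\dim I); elim: k I => // k IH I; rewrite ltnS => le_k idI.
have [->|I0] := pselect (I = 0%VS).
  by exists [::]; rewrite !big_nil dimv0.
have [S [[idS S0] sSI minS]] :=
  min_vspace (P := fun X => ideal {:Q}%VS X /\ X <> 0%VS) (conj idI I0).
have simS : simple_alg S.
  by apply: minimal_ideal_simple => // J idJ J0 /minS; apply.
have [K [idK SK SK0]] := ideal_complement idI idS sSI.
have dimI : \dim I = (\dim S + \dim K)%N by rewrite -SK dimv_disjoint_sum.
have [||s [sP sK dK]] := IH K.
- apply: leq_trans le_k; rewrite dimI -[X in (X < _)%N]add0n ltn_add2r.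
  by rewrite lt0n dimv_eq0; apply/eqP.
- by [].
exists (S :: s); rewrite !big_cons sK -dK; split=> // X.
by rewrite inE => /predU1P[->|/sP].
Qed.

Lemma exists_simple_components :
  exists n (S : 'I_n -> {vspace Q}), simple_components S.
Proof using radQ.
have idQ : ideal {:Q}%VS {:Q}%VS by rewrite /ideal !subvf.
have [s [sP sQ dQ]] := ideal_decomposition idQ.
exists (size s), (tnth (in_tuple s)); split.
- by move=> i; apply: sP; apply: mem_tnth.
- rewrite directvE /= -!(big_tnth _ _ s xpredT id).
  by rewrite -(big_tnth _ _ s xpredT (fun X => \dim X)) sQ dQ.
by rewrite -(big_tnth _ _ s xpredT id).
Qed.

End Semisimple.

(** * The quotient by the radical, strict pairs and bar-minimality *)

Section RadicalQuotient.
Variables (F : fieldType) (A : assocAlgType F).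

(** Lift a radical element to [a]. An idempotent [a s] maps to an idempotent of a nilpotent ideal,
    hence to 0; so it lies in the nilpotent radical of [A] and vanishes. Thus [a] is quasinil. *)
Lemma rad_alg_bar : rad {:alg_bar A}%VS = 0%VS.
Proof.
have [idA nilA _] := radP {:A}%VS.
have [/and3P[_ _ /mulvP rQ] nilQ _] := radP {:alg_bar A}%VS.
apply/eqP; rewrite -subv0; apply/subvP => x Rx; rewrite memv0.
set a := vrepr x; have xa : x = to_bar a by rewrite /to_bar vreprK.
suff Ra : a \in rad {:A}%VS by rewrite xa /to_bar -memv_ker lker_vpi.
apply: quasinil_rad; rewrite ?memvf ?subalgebra_full // => s _ vv.
apply: (idempotent_nilpotent nilA) => //.
rewrite -(lker_vpi (rad {:A}%VS)) memv_ker; apply/eqP.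
have barM (y z : A) : to_bar (y ** z) = to_bar y ** to_bar z by apply: vpiM.
apply: (idempotent_nilpotent nilQ (e := to_bar (a ** s))).
  by rewrite barM -xa rQ ?memvf.
by rewrite /Defs.idempotent -barM vv.
Qed.

Lemma strict_of_eq_bar (e f : A) : to_bar e = to_bar f -> strict_pair e f.
Proof.
move=> ef; have [n [S scS]] := exists_simple_components rad_alg_bar.
by exists n, S; split=> // i; rewrite ef.
Qed.

(* Both members are lifted to idempotents whose images are the identity of    *)
(* [A / rad A], so that strictness holds trivially.                           *)
Lemma strict_pair_above (e f : A) : idempotent e -> idempotent f ->
  exists e' f', [/\ strict_idempotent_pair e' f', e' ** e = e & f ** f' = f].
Proof.
move=> ee ff.
have [e' [_ ee' e'e qe]] := left_identity_above (subvf _) (memvf e) ee.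
have [f' [_ ff' ff'' qf]] := right_identity_above (subvf _) (memvf f) ff.
exists e', f'; split=> //; split=> //; apply: strict_of_eq_bar.
have R c : quasinil {:A}%VS c -> c \in rad {:A}%VS.
  by apply: quasinil_rad; rewrite ?memvf ?subalgebra_full.
(* Modulo the radical [f'] is a right identity and [e'] a left one, so both agree with [e' f']. *)
transitivity (to_bar (e' ** f')); apply/eqP; rewrite /to_bar vpi_eq.
  exact: R (qf _ (memvf _)).
by rewrite -memvN opprB; apply: R (qe _ (memvf _)).
Qed.

Lemma bar_minimal_corner (C B : {vspace A}) :
  2%N \notin [pchar F] -> subalgebra C -> jordan_lie C B -> bar_minimal C B ->
  exists e f, [/\ idempotent e, idempotent f &
    forall b, b \in B -> b = e ** b ** f].
Proof.
move=> char2 algC [innB BB0] [_ minB]; have /mulvP CC := algC.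
have /andP[sBC /lie_brvP BBC] := innB; have BC := subvP sBC.
have BB x y : x \in B -> y \in B -> x ** y = 0.
  by move=> Bx By; apply/eqP; rewrite -memv0 -BB0 memv_amul.
have tripleE a b x : a ** b = 0 -> b ** a = 0 ->
    lie_br a (lie_br b x) = - (a ** x ** b + b ** x ** a).
  move=> ab ba; rewrite /lie_br amulBr amulBl !amulA ab -[x ** b ** a]amulA ba.
  by rewrite amul0l amul0r !subr0 sub0r opprD.
have innerB2 a b x : a \in B -> b \in B -> x \in C ->
    a ** x ** b + b ** x ** a \in B.
  move=> Ba Bb Cx; rewrite -memvN -tripleE ?BB // BBC //.
  exact: (lie_brvP _ _ _ (subvv _)).
have innerB b x : b \in B -> x \in C -> b ** x ** b \in B.
  move=> Bb Cx; have := innerB2 b b x Bb Bb Cx.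
  (* The case [a = b] gives [2 b x b] in [B]; here 2 must be invertible. *)
  rewrite -mulr2n -scaler_nat => /(memvZ 2%:R^-1).
  by rewrite scalerA mulVf ?scale1r // -pcharf0P.
have [e [f [Ce Cf ee ff [eCfB ebf]]]] := inner_ideal_corner algC sBC innerB innerB2.
pose W : {vspace A} := (lmul e @: (rmul f @: C))%VS.
have WP y : reflect (exists2 u, u \in C & y = e ** u ** f) (y \in W).
  apply: (iffP (memv_lmulP _ _ _)) => [[_ /memv_imgP[u Cu ->] ->]|[u Cu ->]].
    by exists u => //; rewrite rmulE amulA.
  by exists (u ** f); rewrite ?amulA // -rmulE memv_img.
have sWB : (W <= B)%VS by apply/subvP => _ /WP[u Cu ->]; apply: eCfB.
(* [W = e C f] is an inner ideal inside [B] with the same image modulo the radical, because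
   [b - e b f] is radical. *)
have WB : W = B.
  apply: minB => //.
    rewrite /inner_ideal (subv_trans sWB) //=; apply/lie_brvP => w1 u Ww1.
    suff : (lie_brv W C <= (lmul w1 - rmul w1) @^-1: W)%VS.
      by move=> /subvP sub /sub; rewrite -memv_preim !lfunE /= opp_lfunE lmulE rmulE.
    apply/lie_brvP => w2 x Ww2 Cx.
    rewrite -memv_preim add_lfunE opp_lfunE lmulE rmulE -/(lie_br w1 (lie_br w2 x)).
    have W2 : forall y z, y \in W -> z \in W -> y ** x ** z \in W.
      move=> _ _ /WP[y Cy ->] /WP[z Cz ->].
      apply/WP; exists (y ** f ** x ** e ** z); last by rewrite !amulA.
      by rewrite !CC.
    have [Bw1 Bw2] := (subvP sWB _ Ww1, subvP sWB _ Ww2).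
    rewrite tripleE ?(BB _ _ Bw1 Bw2) ?(BB _ _ Bw2 Bw1) // memvN.
    by apply: memvD; apply: W2.
  apply/eqP; rewrite eqEsubv limgS //=; apply/subvP => _ /memv_imgP[b Bb ->].
  apply/memv_imgP; exists (e ** b ** f); first by apply/WP; exists b; rewrite ?BC.
  by apply/eqP; rewrite vpi_eq ebf.
exists e, f; split=> // b; rewrite -WB => /WP[u _ ->].
by rewrite !amulA ee -[_ ** f ** f]amulA ff.
Qed.

End RadicalQuotient.

Theorem theorem1p1 (F : closedFieldType)
    (char2 : 2%N \notin [pchar F]) (char3 : 3%N \notin [pchar F])
    (A : assocAlgType F) (perfA : one_perfect {:A}%VS)
    (A' : {vspace A}) (subA' : subalgebra A')
    (B' : {vspace A}) (jlB' : jordan_lie A' B') (bminB' : bar_minimal A' B') :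
  exists e f : A,
    strict_idempotent_pair e f /\
    (forall b : A, b \in B' -> exists a : A, b = e ** a ** f).
Proof.
have [e [f [ee ff ebf]]] := bar_minimal_corner char2 subA' jlB' bminB'.
have [e' [f' [strict e'e ff']]] := strict_pair_above ee ff.
exists e', f'; split=> // b Bb; exists b.
by rewrite {2}(ebf b Bb) !amulA e'e -[_ ** f ** f']amulA ff' -ebf.
Qed.
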